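(* Let $N\ge 3$, let $I_3,\dots,I_N$ be positive integers, and let $\mathcal{X}\in\mathbb{C}^{1\times 1\times I_3\times\cdots\times I_N}$ be a scalar-tensor. Then its block-Toeplitz-plus-Hankel matrix $\mathrm{btph}(\mathcal{X})$ is diagonalizable, and $$\left(C_{I_N}\otimes C_{I_{N-1}}\otimes\cdots\otimes C_{I_3}\right)\,\mathrm{btph}(\mathcal{X})\,\left(C_{I_N}^*\otimes C_{I_{N-1}}^*\otimes\cdots\otimes C_{I_3}^*\right)=\mathrm{diag}(\hat{\mathcal{X}}),$$ where $\hat{\mathcal{X}}=\mathcal{X}\times_3 M_{I_3}\times_4 M_{I_4}\times_5\cdots\times_N M_{I_N}$.
   Context: Kronecker product: $\otimes$; $C^*$ is the conjugate transpose. DCT matrix: $C_n\in\mathbb{R}^{n\times n}$ has entries $(C_n)_{i,j}=\sqrt{\frac{2-\delta_{i,1}}{n}}\cos\left(\frac{(i-1)(2j-1)\pi}{2n}\right)$, $1\le i,j\le n$, with $\delta$ the Kronecker symbol. $W_n=\mathrm{diag}(C_n(:,1))$ is the diagonal matrix whose diagonal is the first column of $C_n$; $Z_n$ is the $n\times n$ matrix with ones on the first superdiagonal and zeros elsewhere; $I_n$ (as a matrix) is the identity; $M_n=W_n^{-1}C_n(I_n+Z_n)$. $n$-mode product: for $U\in\mathbb{C}^{J\times I_n}$, $(\mathcal{X}\times_n U)_{i_1,\dots,i_{n-1},j,i_{n+1},\dots,i_N}=\sum_{i_n}\mathcal{X}_{i_1,\dots,i_N}U_{j,i_n}$. Block-Toeplitz-plus-Hankel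 matrix, defined recursively: for a matrix $A$ (order 2 tensor) $\mathrm{btph}(A)=A$. For a tensor $\mathcal{X}\in\mathbb{C}^{I_1\times I_2\times I_3\times\cdots\times I_N}$, $N\ge 3$, put $n=I_N$ and $\mathcal{X}_k=\mathcal{X}(:,\dots,:,k)$ for $1\le k\le n$; then $\mathrm{btph}(\mathcal{X})$ is the $n\times n$ block matrix whose $(i,j)$ block is $\mathrm{btph}(\mathcal{X}_{|i-j|+1})+H_{ij}$, where $H_{ij}=\mathrm{btph}(\mathcal{X}_{i+j})$ if $i+j\le n$, $H_{ij}=0$ if $i+j=n+1$, and $H_{ij}=\mathrm{btph}(\mathcal{X}_{2n+2-i-j})$ if $i+j\ge n+2$. For a scalar-tensor $\hat{\mathcal{X}}\in\mathbb{C}^{1\times1\times I_3\times\cdots\times I_N}$ and $P=I_3\cdots I_N$, $\mathrm{diag}(\hat{\mathcal{X}})$ is the $P\times P$ diagonal matrix whose $p$-th diagonal entry is $\hat{\mathcal{X}}(1,1,k_3,\dots,k_N)$ with $p=k_3+\sum_{i=4}^N (k_i-1)\prod_{s=3}^{i-1}I_s$. *)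

(* Defs.v *)
From HB Require Import structures.
From mathcomp Require Import all_boot all_order all_algebra.
From mathcomp Require Import complex mxtens.
From mathcomp Require Import reals trigo.

Set Implicit Arguments.
Unset Strict Implicit.
Unset Printing Implicit Defensive.

Import Order.TTheory GRing.Theory Num.Theory.
Local Open Scope ring_scope.
Local Open Scope complex_scope.
Local Open Scope sesquilinear_scope.

(* A shape is I : nat -> nat, with I k the size of mode k (k >= 1, as on      *)
(* paper); only I 1, ..., I N matter for a tensor of order N.  Mode k is the  *)
(* ordinal k - 1 : 'I_N, and indices along a mode start at 0.                 *)
Definition midx (I : nat -> nat) (N : nat) := {dffun forall k : 'I_N, 'I_(I k.+1)}.

Definition tensor (T : Type) (I : nat -> nat) (N : nat) := {ffun midx I N -> T}.

Section MultiIndex.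
Variables (I : nat -> nat) (N : nat).

Definition midx0 : midx I 0 := [ffun k : 'I_0 => False_rect _ (notF (ltn_ord k))].

Lemma ord_last_eq (k : 'I_N.+1) : (k < N)%N <> true -> N = k.
Proof.
by move=> /negP; rewrite -leqNgt => Nk; apply/eqP; rewrite eqn_leq Nk -ltnS ltn_ord.
Qed.

(* (i_1, ..., i_N), a |-> (i_1, ..., i_N, a) *)
Definition midx_rcons (i : midx I N) (a : 'I_(I N.+1)) : midx I N.+1 :=
  [ffun k : 'I_N.+1 =>
     match @idP (k < N)%N with
     | ReflectT kN => i (Ordinal kN)
     | ReflectF nkN => cast_ord (congr1 (fun l => I l.+1) (ord_last_eq nkN)) a
     end].

(* (i_1, ..., i_N) with the index along mode k replaced by a *)
Definition midx_set (i : midx I N) (k : 'I_N) (a : 'I_(I k.+1)) : midx I N :=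
  [ffun l => dfwith i a l].

End MultiIndex.

(* X(:, ..., :, a) *)
Definition last_slice (T : Type) (I : nat -> nat) (N : nat)
    (X : tensor T I N.+1) (a : 'I_(I N.+1)) : tensor T I N :=
  [ffun i : midx I N => X (midx_rcons i a)].

(* The matrix U is taken square, so that the shape does not change. *)
Definition mode_prod (F : pzRingType) (I : nat -> nat) (N : nat)
    (X : tensor F I N) (k : 'I_N) (U : 'M[F]_(I k.+1)) : tensor F I N :=
  [ffun j : midx I N => \sum_(a < I k.+1) X (midx_set j a) * U (j k) a].

(* X x_3 U_{I_3} x_4 ... x_N U_{I_N} *)
Definition mode_prods_from3 (F : pzRingType) (U : forall n, 'M[F]_n)
    (I : nat -> nat) (N : nat) (X : tensor F I N) : tensor F I N :=
  foldl (fun Y (k : 'I_N) => mode_prod Y (U (I k.+1))) X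
    [seq k : 'I_N <- enum 'I_N | (2 <= k)%N].

(* p * I_3 * ... * I_{m+2} *)
Fixpoint btph_dim (p : nat) (I : nat -> nat) (m : nat) : nat :=
  if m is m'.+1 then (I m'.+3 * btph_dim p I m')%N else p.

Section BTPH.
Variables (V : zmodType) (I : nat -> nat).

Definition mx_of_tensor2 (A : tensor V I 2) : 'M[V]_(I 1%N, I 2%N) :=
  \matrix_(i, j) A (midx_rcons (midx_rcons (midx0 I) i) j).

Definition blockmx (n p q : nat) (B : 'I_n -> 'I_n -> 'M[V]_(p, q)) :
    'M[V]_(n * p, n * q) :=
  \matrix_(a, b) B (mxtens_unindex a).1 (mxtens_unindex b).1
                   (mxtens_unindex a).2 (mxtens_unindex b).2.

(* The block (i, j) of the block-Toeplitz-plus-Hankel matrix with slices Y,   *)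
(* for 0-based i, j and slices, so that the slice indices |i-j|+1, i+j and    *)
(* 2n+2-i-j become |i-j|, i+j+1 and 2n-1-i-j.  These are always less than n   *)
(* where they are used, so that the default value of insubd is irrelevant.    *)
Definition btph_block (n p q : nat) (Y : 'I_n -> 'M[V]_(p, q)) (i j : 'I_n) :
    'M[V]_(p, q) :=
  Y (insubd i (maxn i j - minn i j)%N) +
  (if ((i + j).+1 < n)%N then Y (insubd i (i + j).+1)
   else if ((i + j).+1 == n)%N then 0
   else Y (insubd i ((2 * n).-1 - (i + j))%N)).

Fixpoint btph (m : nat) :
    tensor V I m.+2 -> 'M[V]_(btph_dim (I 1%N) I m, btph_dim (I 2%N) I m) :=
  match m with
  | 0 => mx_of_tensor2
  | m'.+1 => fun X : tensor V I m'.+3 =>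
      blockmx (btph_block (fun k : 'I_(I m'.+3) => btph (last_slice X k)))
  end.

End BTPH.

(* 1 x 1 x I_3 x I_4 x ... *)
Definition scalar_shape (I : nat -> nat) (k : nat) : nat :=
  if k is _.+3 then I k else 1%N.

(* A_{I_{m+2}} (x) ... (x) A_{I_3}, the empty product being the 1 x 1         *)
(* identity matrix                                                            *)
Fixpoint kron_from3 (F : pzRingType) (A : forall n, 'M[F]_n) (I : nat -> nat)
    (m : nat) : 'M[F]_(btph_dim 1 I m) :=
  match m with
  | 0 => 1%:M
  | m'.+1 => tensmx (A (I m'.+3)) (kron_from3 A I m')
  end.

Section ScalarDiag.
Variables (I : nat -> nat).
Local Notation J := (scalar_shape I).

(* The multi-index (1, 1, k_3, ..., k_N), N = m + 2, with position p in the   *)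
(* linear order of diag; midx_of_posK is the defining formula for p.          *)
Fixpoint midx_of_pos (m : nat) : 'I_(btph_dim 1 J m) -> midx J m.+2 :=
  match m with
  | 0 => fun=> midx_rcons (midx_rcons (midx0 J) (ord0 : 'I_1)) (ord0 : 'I_1)
  | m'.+1 => fun p : 'I_(J m'.+3 * btph_dim 1 J m') =>
      midx_rcons (midx_of_pos (mxtens_unindex p).2) (mxtens_unindex p).1
  end.

Definition tensor_diag (V : nmodType) (m : nat) (X : tensor V J m.+2) :
    'M[V]_(btph_dim 1 J m) :=
  diag_mx (\row_p X (midx_of_pos p)).

Lemma btph_dim1E (m : nat) : btph_dim 1 J m = (\prod_(3 <= s < m.+3) I s)%N.
Proof.
elim: m => [|m IHm] /=; first by rewrite big_geq.
by rewrite IHm [RHS]big_nat_recr //= mulnC.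
Qed.

Lemma midx_of_posK (m : nat) (p : 'I_(btph_dim 1 J m)) :
  (\sum_(l < m.+2 | 2 <= l) midx_of_pos p l * \prod_(3 <= s < l.+1) I s)%N = p.
Proof.
elim: m p => [p|m IHm p] /=.
  by rewrite big1 => [|[[|[|l]] //]]; case: p => [[]].
rewrite big_mkcond big_ord_recr /= -big_mkcond /=.
rewrite [RHS](divn_eq p (btph_dim 1 J m)) addnC; congr addn.
  rewrite ffunE; case: {-}_ / idP => [lt|]; first by have := ltnn m.+2; rewrite {1}lt.
  by move=> nlt /=; congr muln; rewrite btph_dim1E.
rewrite -[RHS]/(nat_of_ord (mxtens_unindex p).2) -IHm.
apply: eq_bigr => l _; congr muln; rewrite ffunE.
case: {-}_ / idP => [lt|[]]; last by rewrite /= ltn_ord.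
by congr (nat_of_ord (_ _)); apply: val_inj.
Qed.

End ScalarDiag.

Section DCT.
Variables (R : realType) (n : nat).

Definition dct : 'M[R]_n :=
  \matrix_(i < n, j < n)
    (Num.sqrt ((2 - (i == 0 :> nat)%:R) / n%:R)
     * cos ((i * (2 * j + 1))%N%:R * pi / (2 * n)%N%:R)).

Definition dct_W : 'M[R]_n := diag_mx (\row_(i < n) dct i (insubd i 0%N)).

Definition superdiag : 'M[R]_n := \matrix_(i < n, j < n) (i.+1 == j :> nat)%:R.

Definition dct_M : 'M[R]_n := invmx dct_W *m dct *m (1%:M + superdiag).

Definition dctC : 'M[R[i]]_n := map_mx (real_complex R) dct.
Definition dctC_star : 'M[R[i]]_n := dctC ^t*.
Definition dct_MC : 'M[R[i]]_n := map_mx (real_complex R) dct_M.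

End DCT.

(* Main.v *)
(** Slicing along the last mode writes btph(X) as the sum over s of
    [E_s (x) btph(X_s)], where [E_s] is the Toeplitz-plus-Hankel matrix of the
    s-th unit vector; mode products along the earlier modes commute with slicing,
    so by induction on the order it suffices that the DCT matrix C is orthogonal
    and diagonalizes every [E_s], with eigenvalues the column s of M.

    Extend the k-th cosine row c of C to all integer positions j: it is symmetric
    about -1/2 and about n - 1/2.  The Hankel part of [E_s] folds the out-of-range
    positions j - s and j + s back into [0, n) by these two symmetries, so for
    s > 0 the j-th entry of [c E_s] is c(j + s) + c(j - s) = 2 cos(k s pi / n) c(j). *)

Require Import Defs.
From HB Require Import structures.
From mathcomp Require Import all_boot all_order all_algebra.
From mathcomp Require Import complex mxtens.
From mathcomp Require Import reals trigo.
From mathcomp Require Import zify ring.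

Set Implicit Arguments.
Unset Strict Implicit.
Unset Printing Implicit Defensive.

Import Order.TTheory GRing.Theory Num.Theory.
Local Open Scope ring_scope.
Local Open Scope complex_scope.

(** * Sums, products, reflections and shifts of sampled cosines *)

Section CosineSums.
Variable R : realType.
Implicit Types (x : R) (n k l m j s : nat).

Lemma sin_natpi m : sin (m%:R * pi) = 0 :> R.
Proof. by elim: m => [|m IH]; rewrite ?mul0r ?sin0 // -natr1 mulrDl mul1r sinDpi IH oppr0. Qed.

Lemma cos_nat2pi m : cos (m%:R * (pi *+ 2)) = 1 :> R.
Proof. by elim: m => [|m IH]; rewrite ?mul0r ?cos0 // -natr1 mulrDl mul1r cosD2pi. Qed.

(** Telescoping: 2 sin x cos((2j+1)x) = sin((2j+2)x) - sin(2jx). *)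
Lemma sum_cos_odd x n :
  (sin x *+ 2) * (\sum_(j < n) cos ((2 * j + 1)%:R * x)) = sin ((2 * n)%:R * x).
Proof.
elim: n => [|n IH]; first by rewrite big_ord0 mulr0 muln0 mul0r sin0.
rewrite big_ord_recr /= mulrDr IH.
have -> : (2 * n.+1)%:R * x = (2 * n + 1)%:R * x + x by ring.
have -> : (2 * n)%:R * x = (2 * n + 1)%:R * x - x by ring.
by rewrite [in RHS]sinD sinB; ring.
Qed.

(** The row of the DCT matrix without its normalisation; j is any natural number, so that a shift
    may leave [0, n). *)
Definition dct_cos n k j : R := cos ((k * (2 * j + 1))%N%:R * pi / (2 * n)%N%:R).

Lemma sum_dct_cos n k : (0 < k < 2 * n)%N -> \sum_(j < n) dct_cos n k j = 0.
Proof.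
move=> /andP[k0 kn].
have n0 : (2 * n)%:R != 0 :> R by rewrite pnatr_eq0; lia.
(* At x = k pi / (2n) the telescoped sum is sin(k pi) = 0, while sin x > 0 because 0 < x < pi. *)
have := sum_cos_odd (k%:R * pi / (2 * n)%:R) n.
rewrite [in RHS]mulrC divfK // sin_natpi => /eqP; rewrite mulf_eq0 => /orP[|/eqP E]; last first.
  by apply: etrans E; apply: eq_bigr => j _; rewrite /dct_cos natrM -!mulrA mulrCA.
rewrite mulrn_eq0 /= gt_eqF //; apply: sin_gt0_pi.
rewrite divr_gt0 ?mulr_gt0 ?ltr0n ?pi_gt0 //=; last by lia.
by rewrite ltr_pdivrMr ?ltr0n 1?mulrC ?ltr_pM2l ?pi_gt0 ?ltr_nat //; lia.
Qed.

Lemma dct_cosM n k l j :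
  dct_cos n k j * dct_cos n l j *+ 2 = dct_cos n (k + l) j + dct_cos n (maxn k l - minn k l) j.
Proof.
rewrite /dct_cos.
wlog kl : k l / (l <= k)%N => [W|].
  case/orP: (leq_total l k) => /W // {}W.
  by rewrite [(k + l)%N]addnC maxnC minnC -W [X in X *+ 2]mulrC.
rewrite (maxn_idPl kl) (minn_idPr kl) mulnDl mulnBl natrD natrB ?leq_mul2r ?kl ?orbT //.
by rewrite !mulrDl cosD !mulNr cosB; ring.
Qed.

Lemma dct_cos0 n j : dct_cos n 0 j = 1.
Proof. by rewrite /dct_cos mul0n !mul0r cos0. Qed.

(** By product-to-sum, only the frequencies k + l and |k - l| occur; each sums to 0 unless it
    vanishes, and then to n. Both vanish exactly when k = l = 0. *)
Lemma sum_dct_cosM n k l : (k < n)%N -> (l < n)%N ->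
  \sum_(j < n) dct_cos n k j * dct_cos n l j *+ 2 = (n * ((k == l) * (1 + (k == 0%N))))%:R.
Proof.
move=> kn ln; under eq_bigr do rewrite dct_cosM.
rewrite big_split /=.
case: eqVneq => [->|kl].
  rewrite maxnn minnn subnn; under [X in _ + X]eq_bigr do rewrite dct_cos0.
  rewrite sumr_const card_ord mul1n.
  case: (posnP l) => [->|l0].
    by under eq_bigr do rewrite dct_cos0; rewrite sumr_const card_ord -mulrnDr muln2 addnn.
  by rewrite sum_dct_cos ?add0r ?muln1 //; lia.
by rewrite !sum_dct_cos ?addr0 ?mul0n ?muln0 //; lia.
Qed.

(** Symmetry about n - 1/2: the two angles add up to 2 k pi. *)
Lemma dct_cos_reflect n k j : (j < 2 * n)%N -> dct_cos n k (2 * n - j.+1) = dct_cos n k j.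
Proof.
move=> jn; rewrite /dct_cos.
have n0 : (2 * n)%:R != 0 :> R by rewrite pnatr_eq0; lia.
have -> : (k * (2 * (2 * n - j.+1) + 1) = k * 2 * (2 * n) - k * (2 * j + 1))%N.
  by rewrite -mulnA -mulnBr; congr muln; lia.
rewrite natrB; last by rewrite -mulnA leq_mul2l; apply/orP; right; lia.
rewrite !mulrBl cosB.
have -> : (k * 2 * (2 * n))%:R * pi / (2 * n)%:R = k%:R * (pi *+ 2) :> R.
  by rewrite natrM (natrM _ k); field; rewrite pnatr_eq0; lia.
rewrite cos_nat2pi mul1r (_ : k%:R * (pi *+ 2) = (k * 2)%:R * pi); last by ring.
by rewrite sin_natpi mul0r addr0.
Qed.

(** The sum formula for cos(a + y) + cos(a - y); when j - s is negative, evenness of the cosine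
    replaces it by its mirror image s - j - 1 about -1/2. *)
Lemma dct_cosD n k j s :
  dct_cos n k (j + s) + (if (s <= j)%N then dct_cos n k (j - s) else dct_cos n k (s - j.+1))
  = cos ((k * 2 * s)%:R * pi / (2 * n)%:R) *+ 2 * dct_cos n k j.
Proof.
set y := (k * 2 * s)%:R * pi / (2 * n)%:R.
have -> : dct_cos n k (j + s) = cos ((k * (2 * j + 1))%:R * pi / (2 * n)%:R + y).
  by rewrite /y /dct_cos -!mulrDl -natrD; congr (cos (_%:R * _ / _)); lia.
suff -> : (if (s <= j)%N then dct_cos n k (j - s) else dct_cos n k (s - j.+1)) =
   cos ((k * (2 * j + 1))%:R * pi / (2 * n)%:R - y).
  by rewrite cosD cosB /dct_cos; ring.
case: leqP => sj.
  rewrite /y /dct_cos -!mulrBl -natrB; last by rewrite -mulnA leq_mul2l; apply/orP; right; lia.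
  by congr (cos (_%:R * _ / _)); rewrite -mulnA -mulnBr; congr muln; lia.
rewrite -cosN opprB /y /dct_cos -!mulrBl -natrB; last first.
  by rewrite -mulnA leq_mul2l; apply/orP; right; lia.
by congr (cos (_%:R * _ / _)); rewrite -mulnA -mulnBr; congr muln; lia.
Qed.

End CosineSums.

(* btph of the s-th unit vector, seen as a 1 x 1 x n tensor *)
Definition btph_unit (V : pzRingType) n (s : 'I_n) : 'M[V]_n :=
  \matrix_(i, j) ((s == maxn i j - minn i j :> nat)%N%:R +
   (if ((i + j).+1 < n)%N then (s == (i + j).+1 :> nat)%:R
   else if ((i + j).+1 == n)%N then 0
   else (s == (2 * n).-1 - (i + j) :> nat)%N%:R)).

(* The two reflections of the cosine extension: j + s about n - 1/2 and j - s    *)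
(* about -1/2.                                                                 *)
Lemma btph_unitE (V : pzRingType) n (s i j : 'I_n) :
  btph_unit V s i j =
  if s == 0%N :> nat then (i == j)%:R else
  (i == insubd i (if (j + s < n)%N then j + s else 2 * n - (j + s).+1)%N)%:R +
  (i == insubd i (if (s <= j)%N then j - s else s - j.+1)%N)%:R.
Proof.
have [si [ii ji]] := (ltn_ord s, (ltn_ord i, ltn_ord j)).
rewrite mxE -!val_eqE !val_insubd /=.
have [s0|s0] := eqVneq (nat_of_ord s) 0%N.
  rewrite s0.
  have -> : (0 == maxn i j - minn i j)%N = (i == j :> nat) by lia.
  have [_|ijn] := ltnP (i + j).+1 n; first by rewrite addr0.
  have [_|ijn'] := eqVneq (i + j).+1 n; first by rewrite addr0.
  by rewrite (_ : (0 == _)%N = false) ?addr0 //; lia.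
(* Both folded positions lie in [0, n), so [insubd] never takes its default. *)
rewrite (_ : ((if _ then _ else _) < n)%N = true); last by case: ifP; lia.
rewrite (_ : ((if (s <= j)%N then _ else _) < n)%N = true); last by case: ifP; lia.
have -> : (s == maxn i j - minn i j :> nat)%N%:R =
    (i == j + s :> nat)%N%:R + (j == i + s :> nat)%N%:R :> V.
  by rewrite -natrD; congr _%:R; lia.
(* Since 0 < s < n, neither indicator on the right fires on the zero antidiagonal i + j + 1 = n, and
   off it only the one of the matching Hankel branch can. *)
have -> : (if ((i + j).+1 < n)%N then (s == (i + j).+1 :> nat)%:R
    else if (i + j).+1 == n then 0 else (s == (2 * n).-1 - (i + j) :> nat)%N%:R) =
    ((i + j).+1 + s == 2 * n)%N%:R + ((i + j).+1 == s)%N%:R :> V.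
  have [?|?] := ltnP (i + j).+1 n; last have [?|?] := eqVneq (i + j).+1 n;
    by rewrite -natrD -1?[0]/(0%:R); congr _%:R; lia.
(* Regroup one Toeplitz and one Hankel indicator per fold: i = j + s with its mirror image, then i =
   j - s with its own. *)
rewrite addrACA; congr (_ + _).
  by rewrite -natrD; congr _%:R; have [?|?] := ltnP (j + s) n; lia.
by rewrite -natrD; congr _%:R; have [?|?] := leqP s j; lia.
Qed.

(** * Expansion of block matrices into Kronecker products *)

Section Blocks.
Variable F : pzRingType.

Lemma btph_blockE n p q (Y : 'I_n -> 'M[F]_(p, q)) (i j : 'I_n) :
  btph_block Y i j = \sum_(s < n) btph_unit F s i j *: Y s.
Proof.
have [i_lt j_lt] := (ltn_ord i, ltn_ord j).
have pick (a : nat) : (a < n)%N -> Y (insubd i a) = \sum_(s < n) (s == a :> nat)%:R *: Y s.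
  move=> a_lt; rewrite (bigD1 (insubd i a)) //= val_insubd a_lt eqxx scale1r.
  rewrite big1 ?addr0 // => s; rewrite -val_eqE val_insubd a_lt /= => /negbTE ->.
  by rewrite scale0r.
under eq_bigr do rewrite mxE scalerDl.
rewrite big_split /= /btph_block; congr (_ + _); first by apply: pick; lia.
case: ltnP => [ij|ij]; first exact: pick.
case: eqVneq => ij'; first by rewrite big1 // => s _; rewrite scale0r.
by apply: pick; lia.
Qed.

Lemma blockmx_btph_block n p q (Y : 'I_n -> 'M[F]_(p, q)) :
  blockmx (btph_block Y) = \sum_(s < n) tensmx (btph_unit F s) (Y s).
Proof.
apply/matrixP => a b; rewrite mxE btph_blockE !summxE.
by apply: eq_bigr => s _; rewrite [LHS]mxE [RHS]mxE.
Qed.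

Lemma tens_diag_mx n p (u : 'rV[F]_n) (v : 'rV[F]_p) :
  tensmx (diag_mx u) (diag_mx v) =
  diag_mx (\row_a (u 0 (mxtens_unindex a).1 * v 0 (mxtens_unindex a).2)).
Proof.
apply/matrixP => a b; rewrite !mxE.
(* Unindexing is injective, so a = b can be tested on the pairs. *)
rewrite -[a == b](can_eq (@mxtens_unindexK n p)).
rewrite -pair_eqE /=.
by case: eqP; case: eqP => _ _; rewrite ?mulr0n ?mulr1n ?mulr0 ?mul0r.
Qed.

Lemma tens_mx1 n p : tensmx 1%:M 1%:M = 1%:M :> 'M[F]_(n * p).
Proof.
rewrite -!diag_const_mx tens_diag_mx.
by congr diag_mx; apply/rowP => a; rewrite !mxE mulr1.
Qed.

End Blocks.

(** * Mode products and slices along the last mode *)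

Section LastMode.
Variables (I : nat -> nat) (N : nat).
Local Notation widen := (widen_ord (leqnSn N)).

Lemma ord_max_or_widen (k : 'I_N.+1) : k = ord_max \/ exists l : 'I_N, k = widen l.
Proof.
have [kN|Nk] := ltnP k N; last by left; apply/val_inj/eqP; rewrite eqn_leq Nk -ltnS ltn_ord.
by right; exists (Ordinal kN); apply: val_inj.
Qed.

Lemma midx_rcons_last (i : midx I N) a : midx_rcons i a ord_max = a.
Proof.
rewrite ffunE; case: {-}_ / idP => [lt|nlt]; first by have := ltnn N; rewrite {1}lt.
exact: val_inj.
Qed.

Lemma midx_rcons_widen (i : midx I N) a (k : 'I_N) : midx_rcons i a (widen k) = i k.
Proof.
rewrite ffunE; case: {-}_ / idP => [lt|[]]; last by rewrite /= ltn_ord.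
by apply: val_inj; congr (nat_of_ord (i _)); apply: val_inj.
Qed.

Lemma midx_set_last (i : midx I N) a b :
  midx_set (k := ord_max) (midx_rcons i a) b = midx_rcons i b.
Proof.
apply/ffunP => l; rewrite ffunE; case: (ord_max_or_widen l) => [->|[k ->]].
  by rewrite dfwith_in midx_rcons_last.
rewrite dfwith_out ?midx_rcons_widen //.
by rewrite -val_eqE /= neq_ltn ltn_ord orbT.
Qed.

Lemma midx_set_widen (i : midx I N) a (k : 'I_N) b :
  midx_set (k := widen k) (midx_rcons i a) b = midx_rcons (midx_set (k := k) i b) a.
Proof.
apply/ffunP => l; rewrite ffunE; case: (ord_max_or_widen l) => [->|[j ->]].
  rewrite dfwith_out ?midx_rcons_last //.
  by rewrite -val_eqE /= neq_ltn ltn_ord.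
rewrite midx_rcons_widen ffunE; have [->|kj] := eqVneq j k; first by rewrite !dfwith_in.
by rewrite !dfwith_out ?midx_rcons_widen // eq_sym.
Qed.

Variable F : pzRingType.

Lemma last_slice_mode_prod (X : tensor F I N.+1) (k : 'I_N) (U : 'M[F]_(I k.+1)) a :
  last_slice (mode_prod (k := widen k) X U) a = mode_prod (last_slice X a) U.
Proof.
apply/ffunP => j; rewrite ffunE [LHS]ffunE [RHS]ffunE; apply: eq_bigr => b _.
by rewrite midx_set_widen midx_rcons_widen [in RHS]ffunE.
Qed.

Lemma last_slice_mode_prods (U : forall n, 'M[F]_n) (X : tensor F I N.+1)
    (ks : seq 'I_N) a :
  last_slice (foldl (fun Y (k : 'I_N.+1) => mode_prod Y (U (I k.+1))) X (map widen ks)) a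
  = foldl (fun Y (k : 'I_N) => mode_prod Y (U (I k.+1))) (last_slice X a) ks.
Proof. by elim: ks X => //= k ks IH X; rewrite IH last_slice_mode_prod. Qed.

(** The last mode comes last in the fold, so its product is the outer sum and the others act
    slicewise; 2 <= N says that this mode is among those multiplied. *)
Lemma mode_prods_from3_rcons (U : forall n, 'M[F]_n) (X : tensor F I N.+1)
    (j : midx I N) (a : 'I_(I N.+1)) : (2 <= N)%N ->
  mode_prods_from3 U X (midx_rcons j a) =
  \sum_(s < I N.+1) mode_prods_from3 U (last_slice X s) j * U (I N.+1) a s.
Proof.
move=> N2; rewrite /mode_prods_from3 enum_ordSr filter_rcons /= N2 foldl_rcons.
rewrite [LHS]ffunE /=; apply: eq_bigr => s _.
by rewrite midx_set_last midx_rcons_last filter_map -last_slice_mode_prods [in RHS]ffunE.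
Qed.

End LastMode.

(** * Orthogonality of the DCT matrix and its eigenvalues *)

Section DCT.
Variables (R : realType) (n : nat).
Implicit Types k s : 'I_n.

Lemma dctE (k j : 'I_n) :
  dct R n k j = Num.sqrt ((2 - (k == 0 :> nat)%:R) / n%:R) * dct_cos R n k j.
Proof. by rewrite mxE. Qed.

Lemma dct_mul_tr : dct R n *m (dct R n)^T = 1%:M.
Proof.
apply/matrixP => k l; rewrite !mxE.
have [kn ln] := (ltn_ord k, ltn_ord l).
have n0 : n%:R != 0 :> R by rewrite pnatr_eq0; lia.
under eq_bigr do rewrite [_^T _ _]mxE !dctE mulrACA.
rewrite -mulr_sumr.
have := sum_dct_cosM R kn ln; rewrite sumrMnl => /esym E.
have -> : \sum_(j < n) dct_cos R n k j * dct_cos R n l j =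
   (n * ((k == l :> nat) * (1 + (k == 0%N :> nat))))%:R / 2 by rewrite E -mulr_natl; field.
have [<-|kl] := eqVneq k l; last first.
  by rewrite val_eqE (negbTE kl) mul0n muln0 mul0r mulr0.
(* With d = 1 for k = 0 and d = 0 otherwise, (2 - d)/n times n(1 + d)/2 is 1. *)
rewrite -expr2 sqr_sqrtr; last by rewrite divr_ge0 // subr_ge0 ler_nat; case: (_ == _ :> nat).
by rewrite eqxx mul1n natrM; case: (_ == _ :> nat) => /=; field.
Qed.

(** s = 0 is apart: there j + s and j - s coincide and would count the identity twice. *)
Definition btph_eigenvalue k s : R :=
  if s == 0%N :> nat then 1 else cos ((k * 2 * s)%N%:R * pi / (2 * n)%N%:R) *+ 2.

Lemma dct_cos_mul_btph_unit k s j :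
  \sum_(i < n) dct_cos R n k i * btph_unit R s i j =
  btph_eigenvalue k s * dct_cos R n k j.
Proof.
have [sn jn] := (ltn_ord s, ltn_ord j).
under eq_bigr do rewrite btph_unitE.
have pick (a : nat) : (a < n)%N ->
    \sum_(i < n) dct_cos R n k i * (i == insubd i a)%:R = dct_cos R n k a.
  move=> an; rewrite (bigD1 (Ordinal an)) //= big1 ?addr0.
    by rewrite -val_eqE val_insubd an eqxx mulr1.
  by move=> i; rewrite -!val_eqE val_insubd an /= => /negbTE ->; rewrite mulr0.
rewrite /btph_eigenvalue; case: eqVneq => s0.
  rewrite mul1r (bigD1 j) //= big1 ?addr0 ?eqxx ?mulr1 //.
  by move=> i /negbTE ->; rewrite mulr0.
under eq_bigr do rewrite mulrDr.
rewrite big_split /= !pick; [|by case: ifP; lia|by case: ifP; lia].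
rewrite -dct_cosD; congr (_ + _); last by case: ifP.
by case: ifP => // _; rewrite dct_cos_reflect //; lia.
Qed.

Lemma dct_diagonalizes_btph_unit s :
  dct R n *m btph_unit R s *m (dct R n)^T = diag_mx (\row_k btph_eigenvalue k s).
Proof.
have -> : dct R n *m btph_unit R s = diag_mx (\row_k btph_eigenvalue k s) *m dct R n.
  apply/matrixP => k j; rewrite mul_diag_mx !mxE.
  under eq_bigr do rewrite dctE -mulrA.
  by rewrite -mulr_sumr dct_cos_mul_btph_unit mulrCA.
by rewrite -mulmxA dct_mul_tr mulmx1.
Qed.

(** The first cosine of row k has its angle k pi / (2n) in [0, pi/2), so every diagonal entry is
    positive. *)
Lemma dct_W_unit : dct_W R n \in unitmx.
Proof.
rewrite unitmxE det_diag unitfE; apply/prodf_neq0 => i _.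
have i_lt := ltn_ord i.
rewrite mxE dctE mulf_neq0 // gt_eqF //.
  by rewrite sqrtr_gt0 divr_gt0 ?subr_gt0 ?ltr_nat ?ltr0n; [|case: (_ == _ :> nat)|lia].
rewrite val_insubd (_ : (0 < n)%N); last by lia.
apply: cos_gt0_pihalf; apply/andP; split.
  apply: (@lt_le_trans _ _ 0); first by rewrite oppr_lt0 divr_gt0 ?pi_gt0.
  by rewrite divr_ge0 // mulr_ge0 ?pi_ge0.
rewrite muln0 add0n muln1 -mulrA mulrCA ltr_pM2l ?pi_gt0 //.
by rewrite ltr_pdivrMr ?ltr0n ?natrM ?mulKf ?ltr_nat ?pnatr_eq0 //; lia.
Qed.

(** For s > 0, column s of C(I + Z) has entries proportional to c(s) + c(s - 1), which the shift
    identity at j = 0 turns into the eigenvalue times c(0); W divides by the first column. *)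
Lemma dct_ME : dct_M R n = \matrix_(k, s) btph_eigenvalue k s.
Proof.
rewrite /dct_M -mulmxA; apply: (canLR (mulKmx dct_W_unit)).
rewrite mulmxDr mulmx1; apply/matrixP => k s.
have [kn sn] := (ltn_ord k, ltn_ord s).
rewrite mul_diag_mx !mxE -!/(dct_cos R n _ _) val_insubd (_ : (0 < n)%N) /=; last by lia.
under eq_bigr do rewrite dctE mxE -mulrA.
rewrite -mulr_sumr -mulrDr -mulrA; congr (_ * _).
rewrite mulrC /btph_eigenvalue.
have [s0|s0] := posnP s.
  by rewrite s0 mul1r big1 ?addr0 // => i _; rewrite mulr0.
have s1n : (s.-1 < n)%N by lia.
rewrite (bigD1 (Ordinal s1n)) //= big1 => [|i].
  rewrite prednK // eqxx mulr1 addr0.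
  by rewrite -dct_cosD add0n leqNgt s0 /= subn1.
by rewrite -val_eqE /= => /eqP ni; case: eqP => [|_]; rewrite ?mulr0 // => E; case: ni; rewrite -E.
Qed.

Lemma dctC_starE : dctC_star R n = map_mx (real_complex R) (dct R n)^T.
Proof. by apply/matrixP => i j; rewrite !mxE; exact: conjc_real. Qed.

Lemma dctC_diagonalizes_btph_unit s :
  dctC R n *m btph_unit R[i] s *m dctC_star R n = diag_mx (\row_k dct_MC R n k s).
Proof.
have -> : btph_unit R[i] s = map_mx (real_complex R) (btph_unit R s).
  apply/matrixP => i j; rewrite !mxE rmorphD /= !rmorph_nat; congr (_ + _).
  by case: ifP => _; rewrite ?rmorph_nat //; case: ifP => _; rewrite ?rmorph_nat ?rmorph0.
rewrite dctC_starE -!map_mxM dct_diagonalizes_btph_unit.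
by apply/matrixP => i j; rewrite /dct_MC dct_ME !mxE rmorphMn.
Qed.

Lemma dctC_mul_star : dctC R n *m dctC_star R n = 1%:M.
Proof. by rewrite dctC_starE -!map_mxM dct_mul_tr map_mx1. Qed.

End DCT.

(** * Induction on the order of the tensor *)

Section ScalarTensor.
Variables (R : realType) (I : nat -> nat).
Local Notation J := (scalar_shape I).

Lemma kron_from3_dct_mul_star m :
  kron_from3 (@dctC R) J m *m kron_from3 (@dctC_star R) J m = 1%:M.
Proof. by elim: m => [|m IH] /=; rewrite ?mulmx1 // tensmx_mul IH dctC_mul_star tens_mx1. Qed.

Lemma kron_from3_dct_diagonalizes m (X : tensor R[i] J m.+2) :
  kron_from3 (@dctC R) J m *m (btph X : 'M_(btph_dim 1 J m))
    *m kron_from3 (@dctC_star R) J m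
  = tensor_diag (mode_prods_from3 (@dct_MC R) X).
Proof.
elim: m X => [|m IH] X.
  rewrite /= mul1mx mulmx1; apply/matrixP => i j; rewrite !mxE !ord1 eqxx mulr1n.
  by rewrite /mode_prods_from3 !enum_ordSr filter_rcons /= filter_map enum_ord0.
rewrite /= blockmx_btph_block mulmx_sumr mulmx_suml.
(* The mixed-product rule splits each summand into a DCT factor for the last mode and the induction
   hypothesis for slice s. *)
under eq_bigr => s _ do
  rewrite !tensmx_mul dctC_diagonalizes_btph_unit IH /tensor_diag tens_diag_mx.
rewrite -raddf_sum; congr diag_mx; apply/rowP => p.
rewrite !mxE summxE mode_prods_from3_rcons //.
by apply: eq_bigr => s _; rewrite !mxE mulrC.
Qed.

End ScalarTensor.

(* The order of the tensor is N = n + 3. *)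
Theorem theorem3p1 (R : realType) (n : nat) (I : nat -> nat)
  (I_gt0 : forall k : nat, (3 <= k <= n.+3)%N -> (0 < I k)%N)
  (X : tensor R[i] (scalar_shape I) n.+3) :
  let BX : 'M[R[i]]_(btph_dim 1 (scalar_shape I) n.+1) := btph X in
  diagonalizable BX /\
  kron_from3 (@dctC R) (scalar_shape I) n.+1 *m BX
    *m kron_from3 (@dctC_star R) (scalar_shape I) n.+1
  = tensor_diag (mode_prods_from3 (@dct_MC R) X).
Proof.
move=> BX.
have KK := kron_from3_dct_mul_star R I n.+1.
have KBK := kron_from3_dct_diagonalizes X.
split=> //; exists (kron_from3 (@dctC R) (scalar_shape I) n.+1).
  by have [] := mulmx1_unit KK.
apply/similar_diagPp => i j ij; rewrite conjumx; last by have [] := mulmx1_unit KK.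
(* The inverse of the Kronecker product of the C is that of the C*, so the conjugate is the diagonal
   matrix already computed. *)
rewrite -[invmx _]mulmx1 -KK mulKmx; last by have [] := mulmx1_unit KK.
by rewrite KBK !mxE -val_eqE (negbTE ij).
Qed.
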